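(* Let $\tau>0$ and let $\gamma:I\to \mathrm{SL}(2,\mathbb{R})_\tau\subset\mathbb{R}^4_2$ be a proper biharmonic curve parametrized by arc length, with $\gamma'(s)=\cos\vartheta\,E_1+\sin\vartheta\sin\beta(s)\,E_2+\sin\vartheta\cos\beta(s)\,E_3$, where $\vartheta\in(0,\pi/2]$ is constant and $\beta:I\to\mathbb{R}$ is smooth. Let $b=\beta'$ and $a=\frac12\big(-\tau^{-2}+1-(1+\tau^{-2})\cos2\vartheta\big)-\tau^{-1}\cos\vartheta\,\beta'$ (these are constant along $\gamma$), and suppose that $b^2<4a$. Then $$b=-\tau^{-1}(2+\tau^2)\cos\vartheta+\sqrt{(4+5\tau^2)\cos^2\vartheta-4(1+\tau^2)},$$ $$\frac{(2+\tau^2)^2}{4+5\tau^2+\tau^4}<\cos^2\vartheta<1,$$ and the expression of $\gamma$ as a curve in $\mathbb{R}^4_2$ is $$\begin{aligned}\gamma(s)=A\Big(&\cos\big(\tfrac b2 s\big)\cosh(\mu s)+w_{14}\sin\big(\tfrac b2 s\big)\sinh(\mu s),\\ &\sin\big(\tfrac b2 s\big)\cosh(\mu s)-w_{14}\cos\big(\tfrac b2 s\big)\sinh(\mu s),\\ &\cos\big(\tfrac b2 s\big)\sinh(\mu s)\sqrt{1+w_{14}^2},\ \sin\big(\tfrac b2 s\big)\sinh(\mu s)\sqrt{1+w_{14}^2}\Big),\end{aligned}$$ where $$\mu=\frac{\sqrt{4a-b^2}}{2},\qquad w_{14}=\frac{b\tau+2\cos\vartheta}{2\tau\mu}$$ are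 real constants and $A\in\mathrm{O}_2(4)$ is some $4\times4$ indefinite orthogonal (constant) matrix commuting with $J_1$.
   Context: Let $\mathbb{R}^4_2$ be $\mathbb{R}^4$ with the inner product $\langle v,w\rangle=v_1w_1+v_2w_2-v_3w_3-v_4w_4$; identify $\mathbb{R}^4$ with $\mathbb{C}^2$ via $(z,w)=(x_1+ix_2,x_3+ix_4)$, and identify $\mathrm{SL}(2,\mathbb{R})$ with $\{(z,w)\in\mathbb{C}^2: |z|^2-|w|^2=1\}=\{v\in\mathbb{R}^4_2:\langle v,v\rangle=1\}$. On it consider the tangent vector fields $$X_1(z,w)=(iz,iw),\quad X_2(z,w)=(i\bar w,i\bar z),\quad X_3(z,w)=(\bar w,\bar z).$$ For $\tau>0$, $\mathrm{SL}(2,\mathbb{R})_\tau$ denotes $\mathrm{SL}(2,\mathbb{R})$ with the Riemannian metric $g_\tau(X,Y)=-\langle X,Y\rangle+(1+\tau^2)\langle X,X_1\rangle\langle Y,X_1\rangle$. Then $E_1=-\tau^{-1}X_1$, $E_2=X_2$, $E_3=X_3$ is a global orthonormal frame (evaluated at $\gamma(s)$ in formulas for $\gamma'(s)$). Let $\nabla^\tau$ be the Levi-Civita connection of $g_\tau$ and $R(X,Y)Z=\nabla^\tau_X\nabla^\tau_YZ-\nabla^\tau_Y\nabla^\tau_XZ-\nabla^\tau_{[X,Y]}Z$ its curvature. Curves are smooth and defined on an open interval $I$. A curve $\gamma$ parametrized by arc length, with $T=\gamma'$, is biharmonic if its bitension field vanishes, i.e. $(\nabla^\tau_T)^3T-R(T,\nabla^\tau_TT)T=0$;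 it is proper biharmonic if it is biharmonic and not a geodesic. $J_1=\begin{pmatrix}J&0\\0&J\end{pmatrix}$ with $J=\begin{pmatrix}0&-1\\1&0\end{pmatrix}$, and $\mathrm{O}_2(4)=\{A\in\mathrm{GL}(4,\mathbb{R}):A^t=\epsilon A^{-1}\epsilon\}$ with $\epsilon=\mathrm{diag}(1,1,-1,-1)$. $A$ acts on the coordinate vector as a column vector. *)

(* Defs.v *)
From HB Require Import structures.
From mathcomp Require Import all_boot all_order all_algebra.
From mathcomp Require Import all_classical all_reals all_analysis.
From mathcomp Require Import complex.

Set Implicit Arguments.
Unset Strict Implicit.
Unset Printing Implicit Defensive.

Import Order.TTheory GRing.Theory Num.Theory.
Import numFieldNormedType.Exports.

Local Open Scope ring_scope.
Local Open Scope classical_set_scope.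

Definition coshR (R : realType) (x : R) : R := (expR x + expR (- x)) / 2.
Definition sinhR (R : realType) (x : R) : R := (expR x - expR (- x)) / 2.

(* [derive1n n f] is a total function, but near a point of the open set [I] it only
   depends on the restriction of [f] to [I]. *)
Definition smooth_curve (R : realType) (W : normedModType R)
    (I : set R) (f : R -> W) : Prop :=
  forall (n : nat) (s : R), I s -> derivable (derive1n n f) s 1.

(* All iterated directional derivatives exist and are Frechet differentiable. *)
Definition smooth (R : realType) (W : normedModType R)
    (f : 'cV[R]_4 -> W) : Prop :=
  forall (vs : seq 'cV[R]_4) (p : 'cV[R]_4),
    differentiable (foldr (fun v (h : 'cV[R]_4 -> W) q => 'D_v h q) f vs) p.

Section SL2.
Variable R : realType.
Local Notation V := 'cV[R]_4.

Definition vec4 (x1 x2 x3 x4 : R) : V :=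
  \col_(k < 4) nth 0 [:: x1; x2; x3; x4] k.

Definition inner42 (v w : V) : R :=
  v 0 0 * w 0 0 + v 1 0 * w 1 0 - v 2 0 * w 2 0 - v 3 0 * w 3 0.

Definition SL2R : set V := [set p | inner42 p p = 1].

(* The identification of R^4 with C^2 *)
Definition zC (p : V) : R[i] := (p 0 0 +i* p 1 0)%C.
Definition wC (p : V) : R[i] := (p 2 0 +i* p 3 0)%C.
Definition ofC2 (z w : R[i]) : V :=
  vec4 (complex.Re z) (complex.Im z) (complex.Re w) (complex.Im w).

Definition X1 (p : V) : V := ofC2 ('i * zC p)%C ('i * wC p)%C.
Definition X2 (p : V) : V := ofC2 ('i * (wC p)^*)%C ('i * (zC p)^*)%C.
Definition X3 (p : V) : V := ofC2 ((wC p)^*)%C ((zC p)^*)%C.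

(* A smooth vector field on [SL2R] is represented by a smooth map on R^4 that is
   tangent to [SL2R] at the points of [SL2R].  As [SL2R] is a closed embedded
   submanifold, every smooth vector field (or function) on it arises this way;
   two representatives give the same field iff they agree on [SL2R].  The
   directional derivatives taken below are in tangent directions at points of
   [SL2R], hence do not depend on the representatives. *)
Definition tangent_field (X : V -> V) : Prop :=
  smooth X /\ forall p, SL2R p -> inner42 p (X p) = 0.

Definition lie_bracket (X Y : V -> V) : V -> V :=
  fun p => 'D_(X p) Y p - 'D_(Y p) X p.

Section Metric.
Variable tau : R.

Definition gtau (p v w : V) : R :=
  - inner42 v w + (1 + tau ^+ 2) * inner42 v (X1 p) * inner42 w (X1 p).

Definition E1 (p : V) : V := - tau^-1 *: X1 p.
Definition E2 (p : V) : V := X2 p.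
Definition E3 (p : V) : V := X3 p.
Definition frame (k : 'I_3) : V -> V := tnth [tuple E1; E2; E3] k.

Record is_levi_civita (nabla : (V -> V) -> (V -> V) -> V -> V) : Prop := {
  lc_field : forall X Y, tangent_field X -> tangent_field Y ->
    tangent_field (nabla X Y);
  lc_restr : forall X X' Y Y',
    tangent_field X -> tangent_field X' ->
    tangent_field Y -> tangent_field Y' ->
    (forall p, SL2R p -> X p = X' p) -> (forall p, SL2R p -> Y p = Y' p) ->
    forall p, SL2R p -> nabla X Y p = nabla X' Y' p;
  lc_addl : forall X X' Y,
    tangent_field X -> tangent_field X' -> tangent_field Y ->
    forall p, SL2R p ->
      nabla (fun q => X q + X' q) Y p = nabla X Y p + nabla X' Y p;
  lc_scalel : forall (f : V -> R) X Y,
    smooth f -> tangent_field X -> tangent_field Y ->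
    forall p, SL2R p -> nabla (fun q => f q *: X q) Y p = f p *: nabla X Y p;
  lc_addr : forall X Y Y',
    tangent_field X -> tangent_field Y -> tangent_field Y' ->
    forall p, SL2R p ->
      nabla X (fun q => Y q + Y' q) p = nabla X Y p + nabla X Y' p;
  lc_leibniz : forall (f : V -> R) X Y,
    smooth f -> tangent_field X -> tangent_field Y ->
    forall p, SL2R p ->
      nabla X (fun q => f q *: Y q) p
      = 'D_(X p) f p *: Y p + f p *: nabla X Y p;
  lc_torsion_free : forall X Y, tangent_field X -> tangent_field Y ->
    forall p, SL2R p -> nabla X Y p - nabla Y X p = lie_bracket X Y p;
  lc_metric : forall X Y Z,
    tangent_field X -> tangent_field Y -> tangent_field Z ->
    forall p, SL2R p ->
      'D_(X p) (fun q => gtau q (Y q) (Z q)) p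
      = gtau p (nabla X Y p) (Z p) + gtau p (Y p) (nabla X Z p) }.

(* The field with constant frame coefficients whose value at [p] is the tangent
   vector [v]; used to evaluate tensorial expressions on vectors. *)
Definition frame_ext (p v : V) : V -> V :=
  fun q => \sum_(k < 3) gtau p v (frame k p) *: frame k q.

Variable nabla : (V -> V) -> (V -> V) -> V -> V.

Definition curvature_field (X Y Z : V -> V) : V -> V :=
  fun p => nabla X (nabla Y Z) p - nabla Y (nabla X Z) p
           - nabla (lie_bracket X Y) Z p.

Definition curvature (p x y z : V) : V :=
  curvature_field (frame_ext p x) (frame_ext p y) (frame_ext p z) p.

(* Covariant derivative, along [gamma], of a field [Z] of tangent vectors along
   [gamma]: writing Z = sum_k Z^k E_k, it is
   sum_k ((Z^k)' E_k + Z^k nabla_{gamma'} E_k). *)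
Definition cov_deriv (gamma Z : R -> V) : R -> V :=
  fun s => \sum_(k < 3)
    (derive1 (fun t => gtau (gamma t) (Z t) (frame k (gamma t))) s
       *: frame k (gamma s)
     + gtau (gamma s) (Z s) (frame k (gamma s))
       *: nabla (frame_ext (gamma s) (derive1 gamma s)) (frame k) (gamma s)).

Definition arc_length (I : set R) (gamma : R -> V) : Prop :=
  forall s, I s -> gtau (gamma s) (derive1 gamma s) (derive1 gamma s) = 1.

Definition geodesic (I : set R) (gamma : R -> V) : Prop :=
  forall s, I s -> cov_deriv gamma (derive1 gamma) s = 0.

Definition bitension (gamma : R -> V) : R -> V :=
  fun s => iter 3 (cov_deriv gamma) (derive1 gamma) s
    - curvature (gamma s) (derive1 gamma s)
        (cov_deriv gamma (derive1 gamma) s) (derive1 gamma s).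

Definition biharmonic (I : set R) (gamma : R -> V) : Prop :=
  forall s, I s -> bitension gamma s = 0.

Definition proper_biharmonic (I : set R) (gamma : R -> V) : Prop :=
  biharmonic I gamma /\ ~ geodesic I gamma.

End Metric.

Definition J2 : 'M[R]_2 := delta_mx 1 0 - delta_mx 0 1.
Definition J1 : 'M[R]_4 := block_mx J2 0 0 J2.
Definition eps4 : 'M[R]_4 := diag_mx (vec4 1 1 (- 1) (- 1))^T.
Definition O24 : set 'M[R]_4 :=
  [set A | A \in unitmx /\ A^T = eps4 *m invmx A *m eps4].

End SL2.

(* Main.v *)
Require Import Defs.
From HB Require Import structures.
From mathcomp Require Import all_boot all_order all_algebra.
From mathcomp Require Import all_classical all_reals all_analysis.
From mathcomp Require Import ring lra.

Set Implicit Arguments.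
Unset Strict Implicit.
Unset Printing Implicit Defensive.

Import Order.TTheory GRing.Theory Num.Theory.
Import numFieldNormedType.Exports.

Local Open Scope ring_scope.
Local Open Scope classical_set_scope.

(** The fields E1, E2, E3 are restrictions of linear maps of R^4.  Their metric
    products are constant on the quadric, so the Levi-Civita connection is
    determined by their Lie brackets through the Koszul formula
    ([levi_civita_comb]), and the curvature follows by linear algebra
    ([curvature_comb]).

    Put c = cos theta, S = sin theta, T = c E1 + S (sin beta E2 + cos beta E3)
    and N = cos beta E2 - sin beta E3.  Then nabla_T T = k N with
    k = S (beta' + 2 (tau + 1/tau) c).  The component of the bitension field
    along T is -3 k k', so k^2 is constant; the curve is not a geodesic, hence k is
    a nonzero constant and so beta' is a constant b.  The component along N then
    says that k^2 + t^2 is the sectional curvature of the osculating plane, t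
    being the torsion.  After simplification ([proper_biharmonic_angle]) this is
    (b + (2 + tau^2) c / tau)^2 = (4 + 5 tau^2) c^2 - 4 (1 + tau^2).

    The hypothesis b^2 < 4 a is equivalent to (b + 2 c / tau)^2 < 4 S^2.  It
    excludes the smaller root of the quadratic equation ([angle_root]), and for
    the larger one it factors into the bounds on c^2 ([angle_lower_bound]).

    As a curve in C^2, gamma satisfies gamma'' - i b gamma' - a gamma = 0, so
    exp(- i b s / 2) gamma is a combination of cosh (mu s) and sinh (mu s).  With
    delta = (gamma' - (b/2) i gamma) / mu this is the first order system
    gamma' = mu delta + (b/2) i gamma, delta' = mu gamma + (b/2) i delta, whose
    first integrals F and G ([unwind_cst]) satisfy <F, F> = 1, <G, G> = -1,
    <F, G> = 0 and <i F, G> = - w14.  These are the relations needed to map the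
    model curve onto gamma by a complex linear isometry
    ([adapted_matrix], [curve_equation]). *)

(** * Linear vector fields and the global frame *)

Section LinearFields.
Variables (R : realType) (W : normedModType R).
Implicit Types (f : 'cV[R]_4 -> W) (p v : 'cV[R]_4).

(** In coordinates a linear map is a finite sum of coordinate functions with
    vector coefficients, which makes its continuity and differentiability
    elementary. *)
Lemma linear_diff f p : linear f -> differentiable f p.
Proof.
move=> lf.
pose fM := GRing.isLinear.Build _ _ _ _ f lf.
pose fL : {linear 'cV[R]_4 -> W} := HB.pack f fM.
have fE : f = fun q => \sum_(i < 4) q i 0 *: f (delta_mx i 0).
  apply/funext => q; rewrite -[f q]/(fL q) {1}[q]matrix_sum_delta linear_sum.
  by apply: eq_bigr => i _; rewrite big_ord1 linearZ.
rewrite fE; rewrite (_ : (fun q => _) =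
   \sum_(i < 4) (fun q : 'cV[R]_4 => q i 0 *: f (delta_mx i 0))); last first.
  by apply/funext => q; rewrite fct_sumE.
apply: differentiable_sum => i.
have : differentiable ((fun r : R => r *: f (delta_mx i 0))
  \o (fun q : 'cV[R]_4 => q i 0)) p.
  by apply: differentiable_comp => //; exact: differentiable_coord.
by [].
Qed.

Lemma linear_is_derive f p v : linear f -> is_derive p v f (f v).
Proof.
move=> lf; have df := linear_diff p lf.
apply: DeriveDef; first exact: diff_derivable.
rewrite deriveE //.
pose fM := GRing.isLinear.Build _ _ _ _ f lf.
pose fL : {linear 'cV[R]_4 -> W} := HB.pack f fM.
rewrite -[f]/(fL : _ -> _) diff_lin // => q.
by apply: differentiable_continuous; exact: linear_diff.
Qed.

(** The affine maps are stable under directional derivatives: the derivative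
    of a linear map along a fixed vector is constant. Hence all the iterated
    derivatives of an affine map are again affine. *)
Lemma affine_smooth f (c : W) : linear f -> smooth (fun q => f q + c).
Proof.
move=> lf vs p.
suff [g [d [lg ->]]] : exists g d, linear g /\
    foldr (fun v (h : 'cV[R]_4 -> W) q => 'D_v h q) (fun q => f q + c) vs
    = (g + cst d).
  by apply: differentiableD => //; exact: linear_diff.
elim: vs => [|v vs [g [d [lg /= ->]]]]; first by exists f, c.
exists (fun=> 0), (g v); split; first by move=> a x y; rewrite scaler0 addr0.
apply/funext => q.
have ? := linear_is_derive q v lg.
by rewrite derive_val addr0 /= /cst [RHS]add0r.
Qed.

Lemma linear_smooth f : linear f -> smooth f.
Proof.
move=> lf; rewrite (_ : f = fun q => f q + 0); first exact: affine_smooth.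
by apply/funext => q; rewrite addr0.
Qed.

End LinearFields.

Section Frame.
Variable R : realType.
Local Notation V := 'cV[R]_4.
Implicit Types (p q v : V).

Lemma vec4E (a b c d : R) :
  ((vec4 a b c d 0 0 = a) * (vec4 a b c d 1 0 = b) *
   (vec4 a b c d 2 0 = c) * (vec4 a b c d 3 0 = d)).
Proof. by do ![split]; rewrite mxE. Qed.

Lemma ord4_ind (P : 'I_4 -> Prop) : P 0 -> P 1 -> P 2 -> P 3 -> forall i, P i.
Proof.
move=> P0 P1 P2 P3 [[|[|[|[|//]]]] lt].
- by rewrite (_ : Ordinal lt = 0) //; exact/val_inj.
- by rewrite (_ : Ordinal lt = 1) //; exact/val_inj.
- by rewrite (_ : Ordinal lt = 2) //; exact/val_inj.
- by rewrite (_ : Ordinal lt = 3) //; exact/val_inj.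
Qed.

Lemma col4P (v w : V) : v 0 0 = w 0 0 -> v 1 0 = w 1 0 -> v 2 0 = w 2 0 ->
  v 3 0 = w 3 0 -> v = w.
Proof. by move=> h0 h1 h2 h3; apply/colP; apply: ord4_ind. Qed.

Lemma X1E p : X1 p = vec4 (- p 1 0) (p 0 0) (- p 3 0) (p 2 0).
Proof. by rewrite /X1 /ofC2 /=; congr vec4; ring. Qed.
Lemma X2E p : X2 p = vec4 (p 3 0) (p 2 0) (p 1 0) (p 0 0).
Proof. by rewrite /X2 /ofC2 /=; congr vec4; ring. Qed.
Lemma X3E p : X3 p = vec4 (p 2 0) (- p 3 0) (p 0 0) (- p 1 0).
Proof. by rewrite /X3 /ofC2 /=; congr vec4; ring. Qed.

Variable tau : R.
Hypothesis tau0 : tau != 0.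

(** The fields with constant coefficients in the frame. Since E1, E2 and E3
    are restrictions of linear maps of R^4, these fields are linear maps
    too, so that their smoothness and their Lie brackets are matters of
    linear algebra. *)
Definition frame_comb (x1 x2 x3 : R) (p : V) : V :=
  x1 *: E1 tau p + x2 *: E2 p + x3 *: E3 p.

Lemma frame_combE x1 x2 x3 p : frame_comb x1 x2 x3 p =
  vec4 (x1 / tau * p 1 0 + x2 * p 3 0 + x3 * p 2 0)
       (- (x1 / tau * p 0 0) + x2 * p 2 0 - x3 * p 3 0)
       (x1 / tau * p 3 0 + x2 * p 1 0 + x3 * p 0 0)
       (- (x1 / tau * p 2 0) + x2 * p 0 0 - x3 * p 1 0).
Proof.
rewrite /frame_comb /E1 /E2 /E3 X1E X2E X3E.
by apply: col4P; rewrite !(vec4E, mxE) /=; ring.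
Qed.

Lemma frame_comb_linear x1 x2 x3 : linear (frame_comb x1 x2 x3).
Proof.
move=> a u v; rewrite !frame_combE.
by apply: col4P; rewrite !(vec4E, mxE) /=; ring.
Qed.

Lemma frame_comb_tangent x1 x2 x3 p : inner42 p (frame_comb x1 x2 x3 p) = 0.
Proof. by rewrite frame_combE /inner42 !vec4E; ring. Qed.

Lemma tangent_frame_comb x1 x2 x3 : tangent_field (frame_comb x1 x2 x3).
Proof.
split; last by move=> p _; exact: frame_comb_tangent.
exact/linear_smooth/frame_comb_linear.
Qed.

(** Off the quadric the frame is no longer orthonormal, but the products
    still depend only on the quadratic form [inner42 p p]; this is what
    makes their derivatives in tangent directions vanish. *)
Lemma gtau_frame_comb x1 x2 x3 y1 y2 y3 p :
  gtau tau p (frame_comb x1 x2 x3 p) (frame_comb y1 y2 y3 p) =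
  x1 * y1 / tau ^+ 2 * (- inner42 p p + (1 + tau ^+ 2) * inner42 p p ^+ 2)
  + (x2 * y2 + x3 * y3) * inner42 p p.
Proof. by rewrite !frame_combE /gtau X1E /inner42 !vec4E; field. Qed.

Lemma gtau_frame_combSL x1 x2 x3 y1 y2 y3 p : SL2R p ->
  gtau tau p (frame_comb x1 x2 x3 p) (frame_comb y1 y2 y3 p) =
  x1 * y1 + x2 * y2 + x3 * y3.
Proof. by move=> hp; rewrite gtau_frame_comb hp; field. Qed.

Lemma E1_comb p : E1 tau p = frame_comb 1 0 0 p.
Proof. by rewrite /frame_comb scale1r !scale0r !addr0. Qed.

Lemma E2_comb p : E2 p = frame_comb 0 1 0 p.
Proof. by rewrite /frame_comb scale1r !scale0r addr0 add0r. Qed.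

Lemma E3_comb p : E3 p = frame_comb 0 0 1 p.
Proof. by rewrite /frame_comb scale1r !scale0r !add0r. Qed.

Lemma frameE (k : 'I_3) : frame tau k =
  frame_comb (k == 0)%:R (k == 1)%:R (k == 2)%:R.
Proof.
apply/funext => p; rewrite /frame /frame_comb.
case: k => -[|[|[|//]]] lt; rewrite /tnth /= ?scale1r !scale0r ?addr0 ?add0r //.
Qed.

Lemma sum_frame (x : 'I_3 -> R) p :
  \sum_(k < 3) x k *: frame tau k p = frame_comb (x 0) (x 1) (x 2) p.
Proof.
rewrite !big_ord_recr big_ord0 /= add0r /frame_comb.
rewrite (_ : widen_ord _ (widen_ord _ ord_max) = 0); last exact/val_inj.
rewrite (_ : widen_ord _ ord_max = 1); last exact/val_inj.
by rewrite (_ : ord_max = 2) //; exact/val_inj.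
Qed.

Lemma frame_ext_comb p x1 x2 x3 : SL2R p ->
  frame_ext tau p (frame_comb x1 x2 x3 p) = frame_comb x1 x2 x3.
Proof.
move=> hp; apply/funext => q; rewrite /frame_ext sum_frame.
by rewrite !frameE !gtau_frame_combSL //=; congr frame_comb; ring.
Qed.

Lemma inner42_is_derive p v :
  is_derive p v (fun q : V => inner42 q q) (2 * inner42 p v).
Proof.
have d i : is_derive p v (fun q : V => q i 0 : R) (v i 0).
  apply: (@linear_is_derive _ _ (fun q : V => q i 0 : R)).
  by move=> a x y; rewrite !mxE.
rewrite (_ : (fun q => _) =
  (fun q : V => q 0 0) * (fun q : V => q 0 0)
  + (fun q : V => q 1 0) * (fun q : V => q 1 0)
  - (fun q : V => q 2 0) * (fun q : V => q 2 0)
  - (fun q : V => q 3 0) * (fun q : V => q 3 0)) //.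
apply: is_derive_eq; rewrite /inner42 /= /GRing.scale /=; ring.
Qed.

Lemma derive_gtau_comb x1 x2 x3 y1 y2 y3 p v : inner42 p v = 0 ->
  'D_v (fun q => gtau tau q (frame_comb x1 x2 x3 q) (frame_comb y1 y2 y3 q)) p
  = 0.
Proof.
move=> hv; have dN := inner42_is_derive p v.
under eq_fun do rewrite gtau_frame_comb.
pose N : V -> R := fun q : V => inner42 q q.
rewrite (_ : (fun q => _) =
  (x1 * y1 / tau ^+ 2) \*: (- N + (1 + tau ^+ 2) \*: (N ^+ 2))
  + (x2 * y2 + x3 * y3) \*: N) //.
have -> : 0 = (x1 * y1 / tau ^+ 2) *: (- (2 * inner42 p v)
      + (1 + tau ^+ 2) *: ((2%:R * N p ^+ 1) *: (2 * inner42 p v)))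
    + (x2 * y2 + x3 * y3) *: (2 * inner42 p v).
  by rewrite hv mulr0 oppr0 !(scaler0, addr0).
by rewrite derive_val.
Qed.

Lemma lie_bracket_comb x1 x2 x3 y1 y2 y3 :
  lie_bracket (frame_comb x1 x2 x3) (frame_comb y1 y2 y3) =
  frame_comb (2 * tau * (x2 * y3 - x3 * y2)) (2 / tau * (x1 * y3 - x3 * y1))
     (- (2 / tau) * (x1 * y2 - x2 * y1)).
Proof.
apply/funext => p; rewrite /lie_bracket.
have ? := linear_is_derive p (frame_comb x1 x2 x3 p)
  (frame_comb_linear y1 y2 y3).
have ? := linear_is_derive p (frame_comb y1 y2 y3 p)
  (frame_comb_linear x1 x2 x3).
rewrite !derive_val !frame_combE.
by apply: col4P; rewrite !(vec4E, mxE) /=; field.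
Qed.

End Frame.

(** * The Levi-Civita connection and its curvature *)

Section Connection.
Variable R : realType.
Local Notation V := 'cV[R]_4.
Implicit Types (p q v w : V).
Variable tau : R.
Hypothesis tau0 : tau != 0.
Local Notation fc := (frame_comb tau).

Lemma gtauC p v w : gtau tau p v w = gtau tau p w v.
Proof. by rewrite /gtau /inner42; ring. Qed.

Lemma gtauB p v w z : gtau tau p (v - w) z = gtau tau p v z - gtau tau p w z.
Proof. by rewrite /gtau /inner42 !mxE; ring. Qed.

(** The vectors p, X1, X2 and X3 at p are orthogonal for the form of
    signature (2, 2), with squares N, N, -N and -N where N = [inner42 p p];
    expanding N v in this basis is an identity between polynomials. *)
Lemma tangent_decomp p v : SL2R p -> inner42 p v = 0 ->
  v = fc (gtau tau p v (E1 tau p)) (gtau tau p v (E2 p))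
         (gtau tau p v (E3 p)) p.
Proof.
move=> hp hv.
have g1 : gtau tau p v (E1 tau p) = - tau * inner42 v (X1 p).
  transitivity (inner42 v (X1 p) * (1 - (1 + tau ^+ 2) * inner42 p p) / tau).
    rewrite E1_comb frame_combE X1E /gtau X1E /inner42 !vec4E; field; exact: tau0.
  by rewrite hp; field.
have g2 : gtau tau p v (E2 p) = - inner42 v (X2 p).
  by rewrite (E2_comb tau) frame_combE X2E /gtau X1E /inner42 !vec4E; field.
have g3 : gtau tau p v (E3 p) = - inner42 v (X3 p).
  by rewrite (E3_comb tau) frame_combE X3E /gtau X1E /inner42 !vec4E; field.
transitivity (inner42 p p *: v - inner42 p v *: p).
  by rewrite hp hv scale1r scale0r subr0.
rewrite g1 g2 g3 frame_combE X1E X2E X3E.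
by apply: col4P; rewrite !(vec4E, mxE) /inner42 !vec4E /=; field.
Qed.

Variable nabla : (V -> V) -> (V -> V) -> V -> V.
Hypothesis lc : is_levi_civita tau nabla.

(** Products of fields with constant frame coefficients are constant on the
    quadric, so the Koszul formula expresses the connection through Lie
    brackets alone. *)
Lemma levi_civita_comb x1 x2 x3 y1 y2 y3 p : SL2R p ->
  nabla (fc x1 x2 x3) (fc y1 y2 y3) p =
  fc (tau * (x2 * y3 - x3 * y2))
     ((tau + 2 / tau) * (x1 * y3) + tau * (x3 * y1))
     (- (tau + 2 / tau) * (x1 * y2) - tau * (x2 * y1)) p.
Proof.
move=> hp.
have tf a b c := tangent_frame_comb tau a b c.
have met a1 a2 a3 b1 b2 b3 c1 c2 c3 :
    gtau tau p (nabla (fc a1 a2 a3) (fc b1 b2 b3) p) (fc c1 c2 c3 p)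
    = - gtau tau p (nabla (fc a1 a2 a3) (fc c1 c2 c3) p) (fc b1 b2 b3 p).
  have := lc_metric lc (tf a1 a2 a3) (tf b1 b2 b3) (tf c1 c2 c3) hp.
  rewrite derive_gtau_comb //; last exact: frame_comb_tangent.
  rewrite [gtau _ _ (fc b1 b2 b3 p) _]gtauC => /esym/eqP.
  by rewrite addr_eq0 => /eqP.
have tor a1 a2 a3 b1 b2 b3 c1 c2 c3 :
    gtau tau p (nabla (fc a1 a2 a3) (fc b1 b2 b3) p) (fc c1 c2 c3 p)
    = gtau tau p (nabla (fc b1 b2 b3) (fc a1 a2 a3) p) (fc c1 c2 c3 p)
    + (2 * tau * (a2 * b3 - a3 * b2) * c1 + 2 / tau * (a1 * b3 - a3 * b1) * c2
       - 2 / tau * (a1 * b2 - a2 * b1) * c3).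
  have := lc_torsion_free lc (tf a1 a2 a3) (tf b1 b2 b3) hp.
  rewrite lie_bracket_comb //.
  move/(congr1 (fun u => gtau tau p u (fc c1 c2 c3 p))).
  rewrite gtauB gtau_frame_combSL // => /eqP; rewrite subr_eq => /eqP ->.
  by ring.
have kos z1 z2 z3 :
    gtau tau p (nabla (fc x1 x2 x3) (fc y1 y2 y3) p) (fc z1 z2 z3 p) =
    tau * (x2 * y3 - x3 * y2) * z1 +
     ((tau + 2 / tau) * (x1 * y3) + tau * (x3 * y1)) * z2 +
     (- (tau + 2 / tau) * (x1 * y2) - tau * (x2 * y1)) * z3.
  (* The alternating sum of the three torsion identities obtained by cyclic
     permutation of X, Y, Z is twice <nabla_X Y, Z>, once the metric identities
     have paired off the other terms. *)
  have t1 := tor x1 x2 x3 y1 y2 y3 z1 z2 z3.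
  have t2 := tor y1 y2 y3 z1 z2 z3 x1 x2 x3.
  have t3 := tor z1 z2 z3 x1 x2 x3 y1 y2 y3.
  have m1 := met y1 y2 y3 x1 x2 x3 z1 z2 z3.
  have m2 := met z1 z2 z3 y1 y2 y3 x1 x2 x3.
  have m3 := met x1 x2 x3 z1 z2 z3 y1 y2 y3.
  move: t1 t2 t3 m1 m2 m3.
  set G1 := gtau _ _ (nabla (fc x1 x2 x3) (fc y1 y2 y3) p) _.
  set G2 := gtau _ _ (nabla (fc y1 y2 y3) (fc x1 x2 x3) p) _.
  set G3 := gtau _ _ (nabla (fc y1 y2 y3) (fc z1 z2 z3) p) _.
  set G4 := gtau _ _ (nabla (fc z1 z2 z3) (fc y1 y2 y3) p) _.
  set G5 := gtau _ _ (nabla (fc z1 z2 z3) (fc x1 x2 x3) p) _.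
  set G6 := gtau _ _ (nabla (fc x1 x2 x3) (fc z1 z2 z3) p) _.
  set u := 2 / tau.
  move=> t1 t2 t3 m1 m2 m3.
  have n2 : (2 : R) != 0 by rewrite pnatr_eq0.
  apply: (mulfI n2).
  have -> : 2 * G1 = (G1 - G2) - (G3 - G4) + (G5 - G6) by rewrite m1 m2 m3; ring.
  by rewrite t1 t2 t3; ring.
rewrite [LHS](@tangent_decomp p) //; last first.
  by have [_] := lc_field lc (tf x1 x2 x3) (tf y1 y2 y3); apply.
by rewrite (E1_comb tau) (E2_comb tau) (E3_comb tau) !kos; congr frame_comb; ring.
Qed.

(** On fields with constant frame coefficients the curvature is an iterated
    use of the product of [levi_civita_comb]. The sectional curvature is
    tau^2 for the planes that contain E1 and -(4 + 3 tau^2) for the plane of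
    E2 and E3. *)
Lemma curvature_comb x1 x2 x3 y1 y2 y3 z1 z2 z3 p : SL2R p ->
  curvature tau nabla p (fc x1 x2 x3 p) (fc y1 y2 y3 p) (fc z1 z2 z3 p) =
  fc (tau ^+ 2 * ((x1 * y2 - x2 * y1) * z2 + (x1 * y3 - x3 * y1) * z3))
     (- tau ^+ 2 * (x1 * y2 - x2 * y1) * z1
      - (4 + 3 * tau ^+ 2) * (x2 * y3 - x3 * y2) * z3)
     (- tau ^+ 2 * (x1 * y3 - x3 * y1) * z1
      + (4 + 3 * tau ^+ 2) * (x2 * y3 - x3 * y2) * z2) p.
Proof.
move=> hp; rewrite /curvature /curvature_field !frame_ext_comb //.
have tf a b c := tangent_frame_comb tau a b c.
have nn a1 a2 a3 b1 b2 b3 c1 c2 c3 :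
    nabla (fc a1 a2 a3) (nabla (fc b1 b2 b3) (fc c1 c2 c3)) p =
    nabla (fc a1 a2 a3) (fc (tau * (b2 * c3 - b3 * c2))
     ((tau + 2 / tau) * (b1 * c3) + tau * (b3 * c1))
     (- (tau + 2 / tau) * (b1 * c2) - tau * (b2 * c1))) p.
  (* The inner derivative is known only on the quadric, which is enough because
     the connection depends only on the restrictions of its arguments. *)
  apply: (lc_restr lc) => //; first exact: (lc_field lc).
  by move=> q hq; rewrite levi_civita_comb.
rewrite !nn lie_bracket_comb // !levi_civita_comb // !frame_combE.
set q0 := p 0 0; set q1 := p 1 0; set q2 := p 2 0; set q3 := p 3 0.
by apply: col4P; rewrite !(vec4E, mxE) /= ?vec4E; field.
Qed.
End Connection.

(** * Derivatives of real functions *)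

Section Calculus.
Variable R : realType.
Implicit Types (f g : R -> R) (s a b c : R).

(** A plain proposition instead of the class [is_derive]: instance
    resolution would choose the shape of the derivative before unification
    does. *)
Definition has_deriv f s a : Prop := is_derive s (1 : R) f a.

Lemma has_deriv_eq f s a b : has_deriv f s a -> a = b -> has_deriv f s b.
Proof. by move=> ? <-. Qed.

Lemma has_deriv_cst s c : has_deriv (fun=> c) s 0.
Proof. exact: is_derive_cst. Qed.

Lemma has_deriv_id s : has_deriv (fun t => t) s 1.
Proof. exact: is_derive_id. Qed.

Lemma has_derivD s f g a b : has_deriv f s a -> has_deriv g s b ->
  has_deriv (fun t => f t + g t) s (a + b).
Proof. exact: is_deriveD. Qed.

Lemma has_derivN s f a : has_deriv f s a -> has_deriv (fun t => - f t) s (- a).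
Proof. exact: is_deriveN. Qed.

Lemma has_derivM s f g a b : has_deriv f s a -> has_deriv g s b ->
  has_deriv (fun t => f t * g t) s (f s * b + g s * a).
Proof. exact: is_deriveM. Qed.

Lemma has_deriv_sin s f a : has_deriv f s a ->
  has_deriv (fun t => sin (f t)) s (cos (f s) * a).
Proof. exact: (is_derive1_comp (f := @sin R)). Qed.

Lemma has_deriv_cos s f a : has_deriv f s a ->
  has_deriv (fun t => cos (f t)) s (- sin (f s) * a).
Proof. exact: (is_derive1_comp (f := @cos R)). Qed.

Lemma has_deriv_expR s f a : has_deriv f s a ->
  has_deriv (fun t => expR (f t)) s (expR (f s) * a).
Proof. exact: (is_derive1_comp (f := @expR R)). Qed.

Lemma has_deriv_coshR s f a : has_deriv f s a ->
  has_deriv (fun t => coshR (f t)) s (sinhR (f s) * a).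
Proof.
move=> d; rewrite /coshR; apply: has_deriv_eq.
  apply: has_derivM; last exact: has_deriv_cst.
  apply: has_derivD; apply: has_deriv_expR; first exact: d.
  exact: has_derivN d.
by rewrite /sinhR; field.
Qed.

Lemma has_deriv_sinhR s f a : has_deriv f s a ->
  has_deriv (fun t => sinhR (f t)) s (coshR (f s) * a).
Proof.
move=> d; rewrite /sinhR; apply: has_deriv_eq.
  apply: has_derivM; last exact: has_deriv_cst.
  apply: has_derivD; first exact: has_deriv_expR d.
  exact: has_derivN (has_deriv_expR (has_derivN d)).
by rewrite /coshR; field.
Qed.

Lemma has_deriv0_cst (I : set R) f : is_interval I ->
  (forall s, I s -> has_deriv f s 0) -> forall s t, I s -> I t -> f s = f t.
Proof.
move=> Iitv df s t; wlog st : s t / s <= t.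
  move=> H Is It; have [/H|/ltW/H] := leP s t; first exact.
  by move=> ->.
move=> Is It.
have Ist u : s <= u -> u <= t -> I u.
  by move=> su ut; apply: (Iitv s t) => //; rewrite su ut.
have [| | c _] := @MVT_segment _ f (fun=> 0) _ _ st.
- by move=> u /[!in_itv]/= /andP[su ut]; apply: df; apply: Ist; exact: ltW.
- apply: derivable_within_continuous => u /[!in_itv]/= /andP[su ut].
  by have [] := df u (Ist u su ut).
- by rewrite mul0r => /eqP; rewrite subr_eq0 => /eqP.
Qed.
End Calculus.


(** The rules for [coshR] and [sinhR] precede those for sums and products,
    to which their definitions would otherwise be unfolded. *)
Ltac derive_tac := repeat first
  [ eassumption
  | apply: has_deriv_cst | apply: has_deriv_id
  | apply: has_deriv_sin | apply: has_deriv_cos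
  | apply: has_deriv_coshR | apply: has_deriv_sinhR
  | apply: has_derivD | apply: has_derivN | apply: has_derivM ].

Lemma frame_combB (R : realType) (tau x1 x2 x3 y1 y2 y3 : R) p :
  frame_comb tau x1 x2 x3 p - frame_comb tau y1 y2 y3 p =
  frame_comb tau (x1 - y1) (x2 - y2) (x3 - y3) p.
Proof.
by rewrite !frame_combE; apply: col4P; rewrite !(vec4E, mxE) /=; ring.
Qed.

(** * Biharmonic curves of constant angle *)

Section AlongCurve.
Variable R : realType.
Local Notation V := 'cV[R]_4.
Variable tau : R.
Hypothesis tau0 : tau != 0.
Local Notation fc := (frame_comb tau).
Variable nabla : (V -> V) -> (V -> V) -> V -> V.
Hypothesis lc : is_levi_civita tau nabla.
Variables (I : set R) (gamma : R -> V).
Hypotheses (Io : open I) (gammaSL : forall t, I t -> SL2R (gamma t)).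

(** The covariant derivative along a curve, read in the frame: differentiate
    the coefficients and add the connection product of the velocity with the
    field. *)
Lemma cov_deriv_comb (Z : R -> V) (z1 z2 z3 : R -> R) s T1 T2 T3 d1 d2 d3 :
  I s -> (forall t, I t -> Z t = fc (z1 t) (z2 t) (z3 t) (gamma t)) ->
  derive1 gamma s = fc T1 T2 T3 (gamma s) ->
  has_deriv z1 s d1 -> has_deriv z2 s d2 -> has_deriv z3 s d3 ->
  cov_deriv tau nabla gamma Z s =
  fc (d1 + tau * (T2 * z3 s - T3 * z2 s))
     (d2 + (tau + 2 / tau) * (T1 * z3 s) + tau * (T3 * z1 s))
     (d3 - (tau + 2 / tau) * (T1 * z2 s) - tau * (T2 * z1 s)) (gamma s).
Proof.
move=> Is ZE gE e1 e2 e3; have gs := gammaSL Is.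
have IN : \forall t \near s, I t by exact: open_nbhs_nbhs.
have coef (k : 'I_3) :
    derive1 (fun t => gtau tau (gamma t) (Z t) (frame tau k (gamma t))) s
    = (if k == 0 then d1 else if k == 1 then d2 else d3).
  rewrite derive1E.
  rewrite (@near_eq_derive _ _ _ _
    (if k == 0 then z1 else if k == 1 then z2 else z3)).
    case: (k == 0); last case: (k == 1); exact: derive_val.
  near=> t.
  have It : I t by near: t.
  rewrite ZE // frameE gtau_frame_combSL //; last exact: gammaSL.
  by case: k => -[|[|[|//]]] lt /=; rewrite !(mulr0, mulr1, add0r, addr0).
rewrite /cov_deriv big_split /= sum_frame !coef /=.
rewrite (eq_bigr (fun k =>
   gtau tau (gamma s) (Z s) (frame tau k (gamma s)) *:
   nabla (fc T1 T2 T3) (frame tau k) (gamma s))); last first.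
  by move=> k _; rewrite gE frame_ext_comb.
rewrite !big_ord_recr big_ord0 /= add0r !frameE /= !levi_civita_comb // ZE //.
rewrite !gtau_frame_combSL //= !frame_combE.
by apply: col4P; rewrite !(vec4E, mxE) /=; field.
Unshelve. all: by end_near. Qed.

Lemma frame_comb_eq0 x1 x2 x3 y1 y2 y3 p : SL2R p -> fc x1 x2 x3 p = 0 ->
  x1 * y1 + x2 * y2 + x3 * y3 = 0.
Proof.
move=> hp x0; rewrite -(gtau_frame_combSL tau0 _ _ _ _ _ _ hp) x0.
by rewrite /gtau /inner42 !mxE; ring.
Qed.

Variables (c S : R) (beta B1 B2 B3 : R -> R).
Hypothesis cS : c ^+ 2 + S ^+ 2 = 1.
Hypothesis dbeta : forall t, I t -> has_deriv beta t (B1 t).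
Hypothesis dB1 : forall t, I t -> has_deriv B1 t (B2 t).
Hypothesis dB2 : forall t, I t -> has_deriv B2 t (B3 t).
Hypothesis dgamma : forall t, I t ->
  derive1 gamma t = fc c (S * sin (beta t)) (S * cos (beta t)) (gamma t).

(** [k] is the geodesic curvature, with principal normal N = cos beta E2 -
    sin beta E3, and [h] is the part of nabla_T N along sin beta E2 + cos
    beta E3, whose other part is - tau S E1. *)
Let k t := S * (B1 t + 2 * (tau + tau^-1) * c).
Let h t := - (tau + 2 / tau) * c - B1 t.

Lemma tension_comb t : I t ->
  cov_deriv tau nabla gamma (derive1 gamma) t =
  fc 0 (k t * cos (beta t)) (- (k t * sin (beta t))) (gamma t).
Proof.
move=> It; have db := dbeta It.
etransitivity.
  by eapply (cov_deriv_comb It dgamma (dgamma It)); derive_tac.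
by congr frame_comb; rewrite /k; field.
Qed.

Lemma tension2_comb t : I t ->
  cov_deriv tau nabla gamma (cov_deriv tau nabla gamma (derive1 gamma)) t =
  fc (- tau * S * k t)
     (S * B2 t * cos (beta t) + k t * h t * sin (beta t))
     (- (S * B2 t * sin (beta t)) + k t * h t * cos (beta t)) (gamma t).
Proof.
move=> It; have db := dbeta It; have db1 := dB1 It.
etransitivity.
  by eapply (cov_deriv_comb It tension_comb (dgamma It));
    rewrite /k; derive_tac.
rewrite /k /h.
congr frame_comb.
- transitivity (- tau * S * (S * (B1 t + 2 * (tau + tau^-1) * c)) *
   (cos (beta t) ^+ 2 + sin (beta t) ^+ 2)); first by ring.
  by rewrite cos2Dsin2 mulr1.
- by field.
- by field.
Qed.

Lemma tension3_comb t : I t ->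
  iter 3 (cov_deriv tau nabla gamma) (derive1 gamma) t =
  fc (- 2 * tau * S ^+ 2 * B2 t)
     (S * B3 t * cos (beta t)
      + ((h t - B1 t) * S - k t) * B2 t * sin (beta t)
      + k t * h t * B1 t * cos (beta t)
      + (tau + 2 / tau) * c *
        (- (S * B2 t * sin (beta t)) + k t * h t * cos (beta t))
      - tau ^+ 2 * S ^+ 2 * k t * cos (beta t))
     (- (S * B3 t * sin (beta t))
      + ((h t - B1 t) * S - k t) * B2 t * cos (beta t)
      - k t * h t * B1 t * sin (beta t)
      - (tau + 2 / tau) * c *
        (S * B2 t * cos (beta t) + k t * h t * sin (beta t))
      + tau ^+ 2 * S ^+ 2 * k t * sin (beta t)) (gamma t).
Proof.
move=> It; have db := dbeta It; have db1 := dB1 It; have db2 := dB2 It.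
etransitivity.
  by eapply (cov_deriv_comb It tension2_comb (dgamma It));
    rewrite /k /h; derive_tac.
rewrite /k /h; congr frame_comb.
- transitivity (- tau * S ^+ 2 * B2 t - tau * S ^+ 2 * B2 t *
    (cos (beta t) ^+ 2 + sin (beta t) ^+ 2)); first by ring.
  by rewrite cos2Dsin2 mulr1; ring.
- by field.
- by field.
Qed.

(** The components of the bitension field along T and along N. In Frenet
    terms they are -3 k k' and k'' - k (k^2 + t^2 - K), where t is the
    torsion and K the sectional curvature of the osculating plane. *)
Lemma bitension_eq0 t : I t -> bitension tau nabla gamma t = 0 ->
  3 * k t * (S * B2 t) = 0 /\
  S * B3 t = k t * (k t ^+ 2
       + ((tau + 2 / tau) * c ^+ 2 - tau * S ^+ 2 + c * B1 t) ^+ 2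
       - (c ^+ 2 * tau ^+ 2 - S ^+ 2 * (4 + 3 * tau ^+ 2))).
Proof.
move=> It; rewrite /bitension (tension3_comb It) (tension_comb It) (dgamma It).
rewrite (curvature_comb tau0 lc _ _ _ _ _ _ _ _ _ (gammaSL It)) frame_combB => b0.
have proj := frame_comb_eq0 _ _ _ (gammaSL It) b0.
have eT := proj c (S * sin (beta t)) (S * cos (beta t)).
have eN := proj 0 (cos (beta t)) (- sin (beta t)).
move: eT eN; clear proj b0; rewrite /k /h.
have := cos2Dsin2 (beta t).
move: (cos (beta t)) (sin (beta t)) (B1 t) (B2 t) (B3 t).
move=> co si b1 b2 b3 cs eT eN.
have eT' : - 2 * tau * S ^+ 2 * b2 * c
    - S ^+ 2 * b2 * ((4 * tau + 6 / tau) * c + 3 * b1) * (co ^+ 2 + si ^+ 2) = 0.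
  by etransitivity; last exact: eT; field.
have eN' : S * b3 * (co ^+ 2 + si ^+ 2)
    - S * (b1 + 2 * (tau + tau^-1) * c) *
      (((tau + 2 / tau) * c + b1) ^+ 2 + tau ^+ 2 * S ^+ 2 - tau ^+ 2 * c ^+ 2)
      * (co ^+ 2 + si ^+ 2)
    - S * (b1 + 2 * (tau + tau^-1) * c) * (4 + 3 * tau ^+ 2) * S ^+ 2
      * (co ^+ 2 + si ^+ 2) ^+ 2 = 0.
  by etransitivity; last exact: eN; field.
move: eT' eN'; rewrite cs => eT' eN'; split.
  by rewrite -[RHS]oppr0 -[in RHS]eT'; field.
rewrite -[LHS]subr0 -[X in _ - X]eN' !mulr1 expr1n mulr1.
(* Both sides are |nabla_T N|^2, computed in the Frenet frame and in the frame
   E1, N, sin beta E2 + cos beta E3. *)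
have -> : (S * (b1 + 2 * (tau + tau^-1) * c)) ^+ 2
    + ((tau + 2 / tau) * c ^+ 2 - tau * S ^+ 2 + c * b1) ^+ 2
  = (c ^+ 2 + S ^+ 2) * (((tau + 2 / tau) * c + b1) ^+ 2 + tau ^+ 2 * S ^+ 2).
  by field.
by rewrite cS; field.
Qed.

(** The tangential equation k k' = 0 makes k^2 constant, and it is nonzero
    where the curve fails to be geodesic; thus k never vanishes, beta' is
    constant, and the normal equation reduces to k^2 + t^2 = K, a quadratic
    equation for beta'. *)
Lemma proper_biharmonic_angle : is_interval I ->
  proper_biharmonic tau nabla I gamma ->
  (exists s, I s) /\ exists2 b, (forall t, I t -> B1 t = b) &
    (b + (tau + 2 / tau) * c) ^+ 2
    = (4 + 5 * tau ^+ 2) * c ^+ 2 - 4 * (1 + tau ^+ 2).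
Proof.
move=> Iitv [bih /existsNP[s0 /not_implyP[Is0 ngeo]]].
have k0 : k s0 != 0.
  apply/eqP => k0; apply: ngeo; rewrite tension_comb // k0 !mul0r oppr0.
  by rewrite /frame_comb !scale0r !addr0.
have ksq t : I t -> k t * k t = k s0 * k s0.
  move=> It; apply: (has_deriv0_cst (f := fun t => k t * k t) Iitv) => // u Iu.
  have db1 := dB1 Iu; have [e _] := bitension_eq0 Iu (bih u Iu).
  apply: has_deriv_eq; first by rewrite /k; derive_tac.
  have n0 : (3 / 2 : R) != 0 by apply: lt0r_neq0; lra.
  apply: (mulfI n0).
  transitivity (3 * k u * (S * B2 u)); first by rewrite /k /=; field.
  by rewrite e mulr0.
have kt t : I t -> k t != 0.
  move=> It; apply/eqP => kt0; have /eqP := ksq t It.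
  by rewrite kt0 mul0r eq_sym mulf_eq0 (negPf k0).
have S0 : S != 0 by apply: contraNneq k0; rewrite /k => ->; rewrite mul0r.
have B20 t : I t -> B2 t = 0.
  move=> It; have [e _] := bitension_eq0 It (bih t It).
  have n3 : (3 : R) != 0 by rewrite pnatr_eq0.
  have n0 : 3 * k t * S != 0 := mulf_neq0 (mulf_neq0 n3 (kt _ It)) S0.
  apply: (mulfI n0); rewrite [RHS]mulr0.
  by rewrite -[RHS]e [RHS]mulrA.
have B1E t : I t -> B1 t = B1 s0.
  move=> It; apply: (has_deriv0_cst (f := B1) Iitv) => // u Iu.
  by rewrite -(B20 u Iu); exact: dB1.
have B30 : B3 s0 = 0.
  rewrite -(derive_val (is_derive := dB2 Is0)) -(derive_cst (0 : R) s0 1).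
  apply: near_eq_derive; near=> t; apply: B20; near: t.
  exact: open_nbhs_nbhs.
split; first by exists s0.
exists (B1 s0) => //.
have [_] := bitension_eq0 Is0 (bih s0 Is0); rewrite B30 mulr0 => /esym e0.
have e := mulfI k0 (etrans e0 (esym (mulr0 (k s0)))).
rewrite -[RHS]addr0 -[X in _ = _ + X]e /k.
have -> : S ^+ 2 = 1 - c ^+ 2 by rewrite -cS; ring.
have -> : (S * (B1 s0 + 2 * (tau + tau^-1) * c)) ^+ 2
  = (1 - c ^+ 2) * (B1 s0 + 2 * (tau + tau^-1) * c) ^+ 2 by rewrite -cS; ring.
by field.
Unshelve. all: by end_near. Qed.
End AlongCurve.

(** * The admissible angles *)

Section AdmissibleAngle.
Variables (R : realType) (tau c S b : R).
Hypotheses (tau0 : 0 < tau) (c0 : 0 <= c) (cS : c ^+ 2 + S ^+ 2 = 1).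
Let D := (4 + 5 * tau ^+ 2) * c ^+ 2 - 4 * (1 + tau ^+ 2).
Hypothesis bD : (b + (tau + 2 / tau) * c) ^+ 2 = D.
Hypothesis bS : (b + 2 * c / tau) ^+ 2 < 4 * S ^+ 2.

(** For the other root of the quadratic equation, [bS] would force
    tau^2 c^2 < 4 (1 - c^2), which is incompatible with the nonnegativity of
    the discriminant [D]. *)
Lemma angle_root : b = - (tau^-1 * (2 + tau ^+ 2) * c) + Num.sqrt D.
Proof.
have tn0 : tau != 0 by rewrite gt_eqF.
have mE : (tau + 2 / tau) * c = tau^-1 * (2 + tau ^+ 2) * c by field.
suff h : 0 <= b + (tau + 2 / tau) * c.
  by rewrite -bD sqrtr_sqr ger0_norm // mE; ring.
rewrite leNgt; apply/negP => neg.
have xD := bD; set x := b + (tau + 2 / tau) * c in xD neg.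
have bE : b + 2 * c / tau = x - tau * c by rewrite /x; field.
have D0 : 0 <= D by rewrite -bD sqr_ge0.
have tc : 0 <= tau * c by rewrite mulr_ge0 // ltW.
have h1 : (tau * c) ^+ 2 < 4 * S ^+ 2.
  apply: le_lt_trans bS; rewrite bE; nra.
have S2 : S ^+ 2 = 1 - c ^+ 2 by rewrite -cS; ring.
move: h1 D0; rewrite S2 /D exprMn.
have : 0 < tau ^+ 2 by rewrite exprn_gt0.
move: (tau ^+ 2) (c ^+ 2) => t u t0 h1 h2.
have u1 : (4 + t) * u < 4 by lra.
have : (4 + 5 * t) * ((4 + t) * u) < (4 + 5 * t) * 4 by rewrite ltr_pM2l //; lra.
have : (4 + t) * (4 * (1 + t)) <= (4 + t) * ((4 + 5 * t) * u).
  by rewrite ler_pM2l //; lra.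
have : 0 < t * t by rewrite mulr_gt0.
nra.
Qed.

(** Write u = c^2 and r for the square root of [D].  The hypothesis [bS] reads
    (4 + 3 tau^2) u - (4 + 2 tau^2) < tau c r, where the left side is
    nonnegative because [D] is; squaring it yields
    0 < (1 - u) ((4 + 5 tau^2 + tau^4) u - (2 + tau^2)^2). *)
Lemma angle_lower_bound :
  (2 + tau ^+ 2) ^+ 2 / (4 + 5 * tau ^+ 2 + tau ^+ 4) < c ^+ 2.
Proof.
have tn0 : tau != 0 by rewrite gt_eqF.
set r := Num.sqrt D.
have D0 : 0 <= D by rewrite -bD sqr_ge0.
have r0 : 0 <= r by rewrite sqrtr_ge0.
have r2 : r ^+ 2 = D by rewrite sqr_sqrtr.
have bE : b + 2 * c / tau = r - tau * c by rewrite angle_root -/r; field.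
have S2 : S ^+ 2 = 1 - c ^+ 2 by rewrite -cS; ring.
have h : (4 + 3 * tau ^+ 2) * c ^+ 2 - (4 + 2 * tau ^+ 2) < tau * c * r.
  move: bS; rewrite bE S2 sqrrB r2 /D exprMn; lra.
have u1 : c ^+ 2 < 1.
  have : 0 < 4 * S ^+ 2 by apply: le_lt_trans bS; exact: sqr_ge0.
  by rewrite S2; lra.
have t4 : tau ^+ 4 = (tau ^+ 2) ^+ 2 by rewrite -exprM.
have h0 : 0 <= (4 + 3 * tau ^+ 2) * c ^+ 2 - (4 + 2 * tau ^+ 2).
  have : 0 < tau ^+ 2 by rewrite exprn_gt0.
  move: D0; rewrite /D; move: (tau ^+ 2) (c ^+ 2) => t u D0 t0.
  have : (4 + 5 * t) * ((4 + 3 * t) * u - (4 + 2 * t)) >= 0.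
    have : (4 + 3 * t) * ((4 + 5 * t) * u - 4 * (1 + t)) >= 0.
      by rewrite mulr_ge0 //; lra.
    have : 0 < t * t by rewrite mulr_gt0.
    nra.
  by rewrite pmulr_rge0 //; lra.
have sq : ((4 + 3 * tau ^+ 2) * c ^+ 2 - (4 + 2 * tau ^+ 2)) ^+ 2
   < tau ^+ 2 * c ^+ 2 * D.
  by rewrite -r2 -!exprMn ltr_pXn2r // nnegrE // (le_trans h0) // ltW.
have : 0 < tau ^+ 2 by rewrite exprn_gt0.
rewrite t4; move: sq u1; rewrite /D; move: (tau ^+ 2) (c ^+ 2) => t u sq u1 t0.
have t2 : 0 < t ^+ 2 by rewrite exprn_gt0.
have pos : 0 < 4 + 5 * t + t ^+ 2 by lra.
rewrite ltr_pdivrMr // [u * _]mulrC -subr_gt0.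
have : 0 < (1 - u) * ((4 + 5 * t + t ^+ 2) * u - (2 + t) ^+ 2).
  rewrite -(@pmulr_rgt0 _ 4) //.
  rewrite -subr_gt0 in sq; apply: lt_le_trans sq _.
  by rewrite le_eqVlt; apply/orP; left; apply/eqP; ring.
by rewrite pmulr_rgt0 // subr_gt0.
Qed.
End AdmissibleAngle.

(** * The complex structure and the isometries commuting with it *)

Section ComplexStructure.
Variable R : realType.
Local Notation V := 'cV[R]_4.
Implicit Types (p q u v w : V) (x : R).

Lemma sum4 (W : zmodType) (F : 'I_4 -> W) :
  \sum_(i < 4) F i = F 0 + F 1 + F 2 + F 3.
Proof.
rewrite !big_ord_recr big_ord0 /= add0r.
by congr (F _ + F _ + F _ + F _); exact/val_inj.
Qed.

Lemma mul_J1 v : J1 R *m v = X1 v.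
Proof.
have J2E (u : 'cV[R]_2) :
    J2 R *m u = \col_k (if k == 0 then - u 1 0 else u 0 0).
  apply/colP => -[[|[|//]]] lt; rewrite !mxE big_ord_recl big_ord1 !mxE /=.
    by rewrite !mulr0n !mulr1n (_ : lift _ _ = 1); [ring|exact/val_inj].
  by rewrite !mulr0n !mulr1n (_ : lift _ _ = 1); [ring|exact/val_inj].
rewrite X1E -[v in LHS](@vsubmxK _ 2 2) (@mul_block_col _ 2 2 2 2).
rewrite !mul0mx addr0 add0r !J2E.
apply: col4P; rewrite vec4E.
- rewrite (_ : 0 = @lshift 2 2 0) ?(@col_mxEu _ 2 2 1) ?mxE /=.
    by congr (- v _ _); exact/val_inj.
  exact/val_inj.
- rewrite (_ : 1 = @lshift 2 2 1) ?(@col_mxEu _ 2 2 1) ?mxE /=.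
    by congr (v _ _); exact/val_inj.
  exact/val_inj.
- rewrite (_ : 2 = @rshift 2 2 0) ?(@col_mxEd _ 2 2 1) ?mxE /=.
    by congr (- v _ _); exact/val_inj.
  exact/val_inj.
- rewrite (_ : 3 = @rshift 2 2 1) ?(@col_mxEd _ 2 2 1) ?mxE /=.
    by congr (v _ _); exact/val_inj.
  exact/val_inj.
Qed.

(** Multiplication by exp(i x) in C^2. *)
Definition phase x v : V := cos x *: v + sin x *: X1 v.

Lemma phaseKV x : cancel (phase (- x)) (phase x).
Proof.
move=> v; rewrite /phase cosN sinN !X1E; have cs := cos2Dsin2 x.
have e (a : R) : a = (cos x ^+ 2 + sin x ^+ 2) * a by rewrite cs mul1r.
by apply: col4P; rewrite !(vec4E, mxE) /= [RHS]e; ring.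
Qed.

Lemma X1_comb (a b : R) u v : X1 (a *: u + b *: v) = a *: X1 u + b *: X1 v.
Proof. by rewrite !X1E; apply: col4P; rewrite !(vec4E, mxE) /=; ring. Qed.

Lemma X1_phase x v : X1 (phase x v) = phase x (X1 v).
Proof. by rewrite /phase !X1E; apply: col4P; rewrite !(vec4E, mxE) /=; ring. Qed.

Lemma X1X1 v : X1 (X1 v) = - v.
Proof. by rewrite !X1E; apply: col4P; rewrite !(vec4E, mxE). Qed.

Lemma inner42C u v : inner42 u v = inner42 v u.
Proof. by rewrite /inner42; ring. Qed.

Lemma inner42_combl a b u v w :
  inner42 (a *: u + b *: v) w = a * inner42 u w + b * inner42 v w.
Proof. by rewrite /inner42 !mxE; ring. Qed.

Lemma inner42_combr a b u v w :
  inner42 w (a *: u + b *: v) = a * inner42 w u + b * inner42 w v.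
Proof. by rewrite !(inner42C w) inner42_combl. Qed.

Lemma inner42_X1l u v : inner42 (X1 u) v = - inner42 u (X1 v).
Proof. by rewrite !X1E /inner42 !vec4E; ring. Qed.

Lemma inner42_X1_self u : inner42 u (X1 u) = 0.
Proof. by rewrite !X1E /inner42 !vec4E; ring. Qed.

Lemma inner42_phase x u v : inner42 (phase x u) (phase x v) = inner42 u v.
Proof.
rewrite /phase inner42_combl !inner42_combr !inner42_X1l X1X1.
have -> : inner42 u (- v) = - inner42 u v by rewrite /inner42 !mxE; ring.
transitivity ((cos x ^+ 2 + sin x ^+ 2) * inner42 u v); first by ring.
by rewrite cos2Dsin2 mul1r.
Qed.

Lemma coshR2BsinhR2 x : coshR x ^+ 2 - sinhR x ^+ 2 = 1.
Proof.
rewrite /coshR /sinhR; transitivity (expR x * expR (- x)); first by field.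
by rewrite -expRD subrr expR0.
Qed.

Lemma phase_comb (x a b : R) u v :
  phase x (a *: u + b *: v) = a *: phase x u + b *: phase x v.
Proof. by rewrite /phase !X1E; apply: col4P; rewrite !(vec4E, mxE) /=; ring. Qed.

(** The Gram matrix of the columns of A is A^T eps A, and eps is an
    involution. *)
Lemma O24_columns (A : 'M[R]_4) :
  (forall i j, inner42 (col i A) (col j A) = eps4 R i j) -> O24 A.
Proof.
move=> gram.
have eE : eps4 R *m eps4 R = 1%:M.
  rewrite /eps4 mulmx_diag; apply/matrixP => i j; rewrite !mxE.
  by case: i => -[|[|[|[|//]]]] lt; rewrite /= ?mulr1 ?mulrNN ?mulr1.
have gE : A^T *m eps4 R *m A = eps4 R.
  apply/matrixP => i j; rewrite -gram mxE sum4 /eps4 mul_mx_diag !mxE.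
  by rewrite /inner42 !mxE /=; ring.
have inv : (eps4 R *m A^T *m eps4 R) *m A = 1%:M.
  by rewrite -!mulmxA (mulmxA A^T) gE eE.
have [_ uA] := mulmx1_unit inv.
split=> //.
have -> : invmx A = eps4 R *m A^T *m eps4 R.
  by rewrite -[RHS]mulmx1 -(mulmxV uA) mulmxA inv mul1mx.
by rewrite !mulmxA eE mul1mx -mulmxA eE mulmx1.
Qed.

(** Commuting with J1, the multiplication by i, is complex linearity. *)
Lemma commute_J1_columns (A : 'M[R]_4) :
  col 1 A = X1 (col 0 A) -> col 3 A = X1 (col 2 A) -> A *m J1 R = J1 R *m A.
Proof.
move=> c1 c3.
have AE v : A *m v = v 0 0 *: col 0 A + v 1 0 *: col 1 A
    + v 2 0 *: col 2 A + v 3 0 *: col 3 A.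
  by apply/colP => i; rewrite !mxE sum4; ring.
suff h (v : V) : A *m (J1 R *m v) = J1 R *m (A *m v).
  apply/matrixP => i j; have := h (delta_mx j 0).
  by rewrite !mulmxA -!colE => /colP/(_ i); rewrite [LHS]mxE [RHS]mxE.
rewrite !mul_J1 !AE c1 c3 !X1E !vec4E.
by apply: col4P; rewrite !(vec4E, mxE) /=; ring.
Qed.

End ComplexStructure.

(** * Integration of the curve *)

Section HyperbolicSystem.
Variable R : realType.
Local Notation V := 'cV[R]_4.
Variables (I : set R) (P Q : R -> V) (mu b : R).
Hypothesis Iitv : is_interval I.
Hypothesis dP : forall t i, I t ->
  has_deriv (fun u => P u i 0) t (mu * Q t i 0 + b / 2 * X1 (P t) i 0).
Hypothesis dQ : forall t i, I t ->
  has_deriv (fun u => Q u i 0) t (mu * P t i 0 + b / 2 * X1 (Q t) i 0).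

(** The system is P' = mu Q + (b/2) i P, Q' = mu P + (b/2) i Q; this is a
    first integral, and exchanging P and Q gives the second one. *)
Definition unwind (P Q : R -> V) t : V :=
  phase (- (b / 2 * t)) (coshR (mu * t) *: P t + (- sinhR (mu * t)) *: Q t).

Lemma unwind_cst s t : I s -> I t -> unwind P Q s = unwind P Q t.
Proof.
have co (i : 'I_4) (F : R -> R) : (forall u, unwind P Q u i 0 = F u) ->
    (forall u, I u -> has_deriv F u 0) ->
    I s -> I t -> unwind P Q s i 0 = unwind P Q t i 0.
  by move=> FE F0 Is It; rewrite !FE; exact: (has_deriv0_cst (f := F) Iitv).
move=> Is It; apply: col4P; apply: co Is It => [u|u Iu].
all: try by rewrite /unwind /phase cosN sinN X1E !(vec4E, mxE); reflexivity.
all: have [d0 d1 d2 d3] := And4 (dP 0 Iu) (dP 1 Iu) (dP 2 Iu) (dP 3 Iu).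
all: have [e0 e1 e2 e3] := And4 (dQ 0 Iu) (dQ 1 Iu) (dQ 2 Iu) (dQ 3 Iu).
all: apply: has_deriv_eq; first by derive_tac.
all: by rewrite !X1E !vec4E; field.
Qed.
End HyperbolicSystem.

Section Rebuild.
Variable R : realType.
Local Notation V := 'cV[R]_4.
Implicit Types (F G : V).

(** The columns of A are F, i F, f3 and i f3, where f3 is G made orthogonal
    to i F and normalized; they form a basis with Gram matrix eps4. *)
Lemma adapted_matrix F G (w : R) :
  inner42 F F = 1 -> inner42 G G = -1 -> inner42 F G = 0 ->
  inner42 (X1 F) G = - w ->
  exists A : 'M[R]_4, O24 A /\ A *m J1 R = J1 R *m A /\
    forall x ch sh, A *m vec4
      (cos x * ch + w * sin x * sh) (sin x * ch - w * cos x * sh)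
      (cos x * sh * Num.sqrt (1 + w ^+ 2)) (sin x * sh * Num.sqrt (1 + w ^+ 2))
    = phase x (ch *: F + sh *: G).
Proof.
move=> FF GG FG JFG; set r := Num.sqrt (1 + w ^+ 2).
have w1 : 0 < 1 + w ^+ 2 by rewrite ltr_pwDl // sqr_ge0.
have r0 : r != 0 by rewrite gt_eqF // sqrtr_gt0.
have r2 : r ^+ 2 = 1 + w ^+ 2 by rewrite sqr_sqrtr // ltW.
pose f3 : V := r^-1 *: G + (w / r) *: X1 F.
pose A : 'M[R]_4 := \matrix_(i, j) nth 0 [:: F; X1 F; f3; X1 f3] j i 0.
have colA (j : 'I_4) : col j A = nth 0 [:: F; X1 F; f3; X1 f3] j.
  by apply/colP => i; rewrite !mxE.
have NX1 u v : inner42 (- u) v = - inner42 u v :> R.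
  by rewrite /inner42 !mxE; ring.
have JJ u v : inner42 (X1 u) (X1 v) = inner42 u v :> R.
  by rewrite inner42C inner42_X1l X1X1 inner42C NX1 opprK.
have g12 : inner42 F (X1 F) = 0 by exact: inner42_X1_self.
have g13 : inner42 F f3 = 0 by rewrite inner42_combr FG g12; ring.
have g23 : inner42 (X1 F) f3 = 0 by rewrite inner42_combr JFG JJ FF; field.
have g33 : inner42 f3 f3 = -1.
  rewrite {1}/f3 inner42_combl g23 inner42_combr GG inner42C JFG.
  transitivity (- (1 + w ^+ 2) / r ^+ 2); first by field.
  by rewrite -r2; field.
have g14 : inner42 F (X1 f3) = 0 by rewrite -[LHS]opprK -inner42_X1l g23 oppr0.
have g34 : inner42 f3 (X1 f3) = 0 by exact: inner42_X1_self.
exists A; split; [|split].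
- apply: O24_columns => i j; rewrite !colA /eps4.
  case: i => [[|[|[|[|//]]]] ?]; case: j => [[|[|[|[|//]]]] ?];
  rewrite !mxE /=;
  by rewrite ?JJ ?(FF, g12, g13, g23, g33, g14, g34) // inner42C
     ?JJ ?(FF, g12, g13, g23, g33, g14, g34).
- by apply: commute_J1_columns; rewrite !colA.
- move=> x ch sh.
  have GE : G = r *: f3 + (- w) *: X1 F.
    by apply/colP => i; rewrite !mxE; field.
  have -> : A *m vec4 (cos x * ch + w * sin x * sh) (sin x * ch - w * cos x * sh)
       (cos x * sh * r) (sin x * sh * r)
    = (cos x * ch + w * sin x * sh) *: F
      + (sin x * ch - w * cos x * sh) *: X1 F
      + (cos x * sh * r) *: f3 + (sin x * sh * r) *: X1 f3.
    by apply/colP => i; rewrite mxE sum4 !vec4E ![A _ _]mxE !mxE /=; ring.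
  rewrite phase_comb GE phase_comb /phase X1X1; clear GE.
  by move: (X1 F) (X1 f3) => X Y; apply/colP => i; rewrite !mxE; ring.
Qed.

End Rebuild.

Section CurveEquation.
Variable R : realType.
Local Notation V := 'cV[R]_4.
Variables (tau c S b mu : R) (I : set R) (gamma : R -> V) (beta : R -> R).
Hypotheses (tau0 : tau != 0) (mu0 : mu != 0).
Hypothesis mu2 : mu ^+ 2 = S ^+ 2 - (c / tau + b / 2) ^+ 2.
Hypothesis Iitv : is_interval I.
Hypothesis gammaSL : forall t, I t -> SL2R (gamma t).
Hypothesis gammad : forall t, I t -> derivable gamma t 1.
Hypothesis dbeta : forall t, I t -> has_deriv beta t b.
Hypothesis dgamma : forall t, I t -> derive1 gamma t =
  frame_comb tau c (S * sin (beta t)) (S * cos (beta t)) (gamma t).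

(** The vector (gamma' - (b/2) i gamma) / mu, in frame coordinates. *)
Let delta t := frame_comb tau ((c + b / 2 * tau) / mu)
  (S * sin (beta t) / mu) (S * cos (beta t) / mu) (gamma t).

Lemma velocity_coord t (i : 'I_4) : I t -> has_deriv (fun u => gamma u i 0) t
  (frame_comb tau c (S * sin (beta t)) (S * cos (beta t)) (gamma t) i 0).
Proof.
move=> It; have dg := gammad It.
rewrite -dgamma // derive1E derive_mx // mxE; apply: derivableP.
exact: (derivable_mxP _ _ _).1 dg i 0.
Qed.

Lemma gamma_coord t (i : 'I_4) : I t ->
  has_deriv (fun u => gamma u i 0) t
    (mu * delta t i 0 + b / 2 * X1 (gamma t) i 0).
Proof.
move=> It; apply: has_deriv_eq; first exact: velocity_coord.
suff -> : frame_comb tau c (S * sin (beta t)) (S * cos (beta t)) (gamma t) =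
  mu *: delta t + (b / 2) *: X1 (gamma t) by rewrite !mxE.
rewrite /delta !frame_combE X1E.
by apply: col4P; rewrite !(vec4E, mxE) /=; field; rewrite ?tau0 ?mu0.
Qed.

(** This is the equation gamma'' - i b gamma' - a gamma = 0 in disguise,
    with a = mu^2 + b^2/4; its coefficients are constant because beta' is. *)
Lemma delta_coord t (i : 'I_4) : I t ->
  has_deriv (fun u => delta u i 0) t
    (mu * gamma t i 0 + b / 2 * X1 (delta t) i 0).
Proof.
move=> It; have db := dbeta It.
have [d0 d1 d2 d3] : [/\ _, _, _ & _] :=
  And4 (velocity_coord 0 It) (velocity_coord 1 It)
       (velocity_coord 2 It) (velocity_coord 3 It).
rewrite frame_combE !vec4E in d0 d1 d2 d3.
have SE : S ^+ 2 * (cos (beta t) ^+ 2 + sin (beta t) ^+ 2)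
    = mu ^+ 2 + (c / tau + b / 2) ^+ 2 by rewrite cos2Dsin2 mu2; ring.
apply: (ord4_ind (P := fun i => has_deriv (fun u => delta u i 0) t
  (mu * gamma t i 0 + b / 2 * X1 (delta t) i 0))); rewrite X1E !vec4E /delta.
all: under eq_fun do rewrite frame_combE vec4E.
all: apply: has_deriv_eq; first by derive_tac.
all: rewrite frame_combE !vec4E.
all: move: SE d0 d1 d2 d3.
all: move: (cos (beta t)) (sin (beta t)).
all: move: (gamma t 0 0) (gamma t 1 0) (gamma t 2 0) (gamma t 3 0).
all: move=> x0 x1 x2 x3 co si SE _ _ _ _.
all: apply/eqP; rewrite -subr_eq0; apply/eqP.
all: have zero x : (S ^+ 2 * (co ^+ 2 + si ^+ 2)
    - (mu ^+ 2 + (c / tau + b / 2) ^+ 2)) / mu * x = 0 by rewrite SE subrr !mul0r.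
- by rewrite -[RHS](zero x0); field; rewrite tau0 mu0.
- by rewrite -[RHS](zero x1); field; rewrite tau0 mu0.
- by rewrite -[RHS](zero x2); field; rewrite tau0 mu0.
- by rewrite -[RHS](zero x3); field; rewrite tau0 mu0.
Qed.

(** The two first integrals F and G satisfy the same product relations as
    gamma and delta at any point, which are the hypotheses of
    [adapted_matrix]; solving for gamma gives the formula. *)
Lemma curve_equation : (exists s, I s) ->
  let w := (b * tau + 2 * c) / (2 * tau * mu) in
  exists A : 'M[R]_4, O24 A /\ A *m J1 R = J1 R *m A /\
    forall s, I s -> gamma s = A *m vec4
      (cos (b / 2 * s) * coshR (mu * s) + w * sin (b / 2 * s) * sinhR (mu * s))
      (sin (b / 2 * s) * coshR (mu * s) - w * cos (b / 2 * s) * sinhR (mu * s))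
      (cos (b / 2 * s) * sinhR (mu * s) * Num.sqrt (1 + w ^+ 2))
      (sin (b / 2 * s) * sinhR (mu * s) * Num.sqrt (1 + w ^+ 2)).
Proof.
move=> [s0 Is0] w.
pose F := unwind mu b gamma delta s0; pose G := unwind mu b delta gamma s0.
have FE s : I s -> F = unwind mu b gamma delta s.
  by move=> Is; exact: (unwind_cst Iitv gamma_coord delta_coord Is0 Is).
have GE s : I s -> G = unwind mu b delta gamma s.
  by move=> Is; exact: (unwind_cst Iitv delta_coord gamma_coord Is0 Is).
have gg : inner42 (gamma s0) (gamma s0) = 1 := gammaSL Is0.
have gd : inner42 (gamma s0) (delta s0) = 0 by exact: frame_comb_tangent.
have dd : inner42 (delta s0) (delta s0) = - 1.
  have cs := cos2Dsin2 (beta s0).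
  transitivity (((c / tau + b / 2) ^+ 2 - S ^+ 2 *
    (cos (beta s0) ^+ 2 + sin (beta s0) ^+ 2)) / mu ^+ 2
    * inner42 (gamma s0) (gamma s0)).
    by rewrite /delta frame_combE /inner42 !vec4E; field; rewrite tau0 mu0.
  rewrite cs gg mulr1 mulr1 -opprB -mu2; field; exact: mu0.
have jgd : inner42 (X1 (gamma s0)) (delta s0) = - w.
  transitivity (- w * inner42 (gamma s0) (gamma s0)); last by rewrite gg mulr1.
  by rewrite /w /delta frame_combE X1E /inner42 !vec4E; field; rewrite tau0 mu0.
have hyp := coshR2BsinhR2 (mu * s0).
have [||||A [OA [cA AE]]] := @adapted_matrix _ F G w.
- rewrite /F /unwind inner42_phase inner42_combl !inner42_combr.
  rewrite gg dd gd inner42C gd.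
  by rewrite -[RHS]hyp; ring.
- rewrite /G /unwind inner42_phase inner42_combl !inner42_combr.
  rewrite gg dd gd inner42C gd.
  by rewrite -[in RHS]hyp; ring.
- rewrite /F /G /unwind inner42_phase inner42_combl !inner42_combr.
  rewrite gg dd gd inner42C gd.
  by ring.
- rewrite /F /G /unwind X1_phase inner42_phase X1_comb.
  rewrite inner42_combl !inner42_combr jgd inner42_X1l inner42_X1_self.
  rewrite inner42_X1l inner42_X1_self inner42_X1l inner42C jgd.
  by rewrite -[RHS]mulr1 -hyp; ring.
exists A; split=> //; split=> // s Is.
rewrite AE (FE s Is) (GE s Is) /unwind -phase_comb phaseKV.
have e : forall a : R, a = (coshR (mu * s) ^+ 2 - sinhR (mu * s) ^+ 2) * a.
  by move=> a; rewrite coshR2BsinhR2 mul1r.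
by apply/colP => i; rewrite !mxE [LHS]e; ring.
Qed.

End CurveEquation.

(** * Proper biharmonic curves with b^2 < 4 a *)

Theorem theorem6p1 (R : realType) (tau : R)
    (nabla : ('cV[R]_4 -> 'cV[R]_4) -> ('cV[R]_4 -> 'cV[R]_4)
             -> 'cV[R]_4 -> 'cV[R]_4)
    (I : set R) (gamma : R -> 'cV[R]_4) (theta : R) (beta : R -> R) :
  0 < tau ->
  is_levi_civita tau nabla ->
  open I -> is_interval I ->
  (forall s, I s -> SL2R (gamma s)) ->
  smooth_curve I gamma ->
  arc_length tau I gamma ->
  proper_biharmonic tau nabla I gamma ->
  0 < theta -> theta <= pi / 2 ->
  smooth_curve I beta ->
  (forall s, I s ->
    derive1 gamma s = cos theta *: E1 tau (gamma s)
                  + (sin theta * sin (beta s)) *: E2 (gamma s)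
                  + (sin theta * cos (beta s)) *: E3 (gamma s)) ->
  exists b a : R,
    (forall s, I s -> derive1 beta s = b) /\
    (forall s, I s ->
       2^-1 * (- tau ^- 2 + 1 - (1 + tau ^- 2) * cos (2 * theta))
       - tau^-1 * cos theta * derive1 beta s = a) /\
    (b ^+ 2 < 4 * a ->
      let mu := Num.sqrt (4 * a - b ^+ 2) / 2 in
      let w14 := (b * tau + 2 * cos theta) / (2 * tau * mu) in
      b = - (tau^-1 * (2 + tau ^+ 2) * cos theta)
          + Num.sqrt ((4 + 5 * tau ^+ 2) * cos theta ^+ 2
                      - 4 * (1 + tau ^+ 2)) /\
      (2 + tau ^+ 2) ^+ 2 / (4 + 5 * tau ^+ 2 + tau ^+ 4)
        < cos theta ^+ 2 /\
      cos theta ^+ 2 < 1 /\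
      exists A : 'M[R]_4,
        O24 A /\ A *m J1 R = J1 R *m A /\
        forall s, I s ->
          gamma s = A *m vec4
            (cos (b / 2 * s) * coshR (mu * s)
             + w14 * sin (b / 2 * s) * sinhR (mu * s))
            (sin (b / 2 * s) * coshR (mu * s)
             - w14 * cos (b / 2 * s) * sinhR (mu * s))
            (cos (b / 2 * s) * sinhR (mu * s) * Num.sqrt (1 + w14 ^+ 2))
            (sin (b / 2 * s) * sinhR (mu * s) * Num.sqrt (1 + w14 ^+ 2))).
Proof.
move=> tau0 lc Io Iitv gammaSL gammas _ gammab th0 th1 betas gammaE.
have tn0 : tau != 0 by rewrite gt_eqF.
have dB n t : I t -> has_deriv (derive1n n beta) t (derive1n n.+1 beta t).
  by move=> It; rewrite derive1nS derive1E; apply: derivableP; exact: betas.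
have c0 : 0 <= cos theta.
  apply: cos_ge0_pihalf; rewrite th1 andbT (le_trans _ (ltW th0)) //.
  by rewrite oppr_le0 divr_ge0 // pi_ge0.
have S0 : 0 < sin theta.
  apply: sin_gt0_pi; rewrite th0 (le_lt_trans th1) // ltr_pdivrMr //.
  by rewrite ltr_pMr ?pi_gt0 // ltr1n.
have cS := cos2Dsin2 theta.
have [Ine [b bE' bD]] := proper_biharmonic_angle tn0 lc Io gammaSL cS
  (dB 0) (dB 1) (dB 2) gammaE Iitv gammab.
have bE t : I t -> derive1 beta t = b := bE' t.
exists b, (2^-1 * (- tau ^- 2 + 1 - (1 + tau ^- 2) * cos (2 * theta))
       - tau^-1 * cos theta * b).
split=> //; split=> [s Is|]; first by rewrite (bE s Is).
set a := _ - _ * b => ba mu w14.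
have quad : 4 * a - b ^+ 2 = 4 * sin theta ^+ 2 - (b + 2 * cos theta / tau) ^+ 2.
  rewrite /a (_ : 2 * theta = theta + theta); last by ring.
  rewrite cosD -!expr2 (_ : sin theta ^+ 2 = 1 - cos theta ^+ 2).
    by field.
  by rewrite -cS; ring.
(* The condition b^2 < 4 a is the positivity of 4 mu^2. *)
have bS : (b + 2 * cos theta / tau) ^+ 2 < 4 * sin theta ^+ 2.
  by rewrite -subr_gt0 -quad subr_gt0.
have disc0 : 0 < 4 * a - b ^+ 2 by rewrite subr_gt0.
have mu0 : mu != 0.
  by rewrite mulf_neq0 ?invr_eq0 ?pnatr_eq0 // gt_eqF // sqrtr_gt0.
have mu2 : mu ^+ 2 = sin theta ^+ 2 - (cos theta / tau + b / 2) ^+ 2.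
  by rewrite /mu exprMn sqr_sqrtr ?ltW // quad; field.
split; first exact: angle_root bD bS.
split; first exact: angle_lower_bound bD bS.
split; first by rewrite -cS ltrDl exprn_gt0.
have dbeta t : I t -> has_deriv beta t b.
  by move=> It; rewrite -(bE t It); exact: (dB 0%N).
exact: (curve_equation tn0 mu0 mu2 Iitv gammaSL (gammas 0%N) dbeta gammaE Ine).
Qed.
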